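(* Let $\Omega$ be a finite set with $|\Omega|=n$, let $G\le \mathrm{Sym}(\Omega)$ be a permutation group with $G\neq\{e\}$, and let $\mu$ be the minimal degree of $G$, i.e. $\mu=\min_{g\in G,\,g\ne e}|\{\omega\in\Omega: g(\omega)\ne\omega\}|$. (i) For every integer $m$ with $0<m<n$, the natural action of $G$ on the set $\Omega_m$ of $m$-element subsets of $\Omega$ satisfies $$\frac{\langle \mathrm{Stab}\rangle_m-1}{|G|}<3\sqrt{\frac{m(n-m)}{n}}\;\xi_1^{\mu},\qquad \xi_1=\frac{\sqrt{m^2+(n-m)^2}}{n}.$$ (ii) For every integer $m>0$, the natural action of $G$ on the set $\Omega_{(m)}$ of multisets of weight $m$ on $\Omega$ satisfies $$\frac{\langle \mathrm{Stab}\rangle_{(m)}-1}{|G|}<3\sqrt{\frac{m(n+m)}{n}}\;\xi_2^{\mu},\qquad \xi_2=\left(\frac{n}{n+2m}\right)^{1/2}.$$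
   Context: A multiset of weight $m$ on $\Omega$ is a function $\varkappa:\Omega\to\mathbb{Z}_{\ge 0}$ with $\sum_{\omega\in\Omega}\varkappa(\omega)=m$. $G$ acts naturally on $\Omega_m$ and on $\Omega_{(m)}$. For an action of a finite group $G$ on a finite nonempty set $S$, the average stabilizer size is $\frac1{|S|}\sum_{s\in S}|\mathrm{Stab}_G(s)|$, which equals $|G|\cdot|S/G|/|S|$. $\langle\mathrm{Stab}\rangle_m$ and $\langle\mathrm{Stab}\rangle_{(m)}$ denote this average for $S=\Omega_m$ and $S=\Omega_{(m)}$ respectively. *)

(* Defs.v *)
From mathcomp Require Import all_boot all_order all_fingroup all_algebra.
From mathcomp Require Import reals.

Set Implicit Arguments.
Unset Strict Implicit.
Unset Printing Implicit Defensive.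

Import Order.TTheory GRing.Theory Num.Theory.

Local Open Scope ring_scope.

Definition avg_stab (R : realType) (aT : finGroupType) (rT : finType)
    (to : {action aT &-> rT}) (G : {group aT}) (S : {set rT}) : R :=
  (\sum_(s in S) #|'C_G[s | to]|%g%:R) / #|S|%:R.

Definition moved_points (T : finType) (g : {perm T}) : {set T} :=
  [set x | g x != x].

(* Every #|moved_points g| is at most #|T|, so the starting value #|T| of the
   iterated minimum does not alter it; it is the value when G is trivial. *)
Definition minimal_degree (T : finType) (G : {group {perm T}}) : nat :=
  \big[minn/#|T|]_(g in G | g != 1%g) #|moved_points g|.

Definition subsets_of_card (T : finType) (m : nat) : {set {set T}} :=
  [set A : {set T} | #|A| == m].

(* A multiset of weight m has all its multiplicities at most m, so taking them
   in 'I_m.+1 rather than nat loses nothing (see multisetsP) and makes the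
   multisets elements of a finite type. *)
Definition multisets (T : finType) (m : nat) : {set {ffun T -> 'I_m.+1}} :=
  [set k : {ffun T -> 'I_m.+1} | (\sum_x (k x : nat))%N == m].

Lemma multisetsP (T : finType) (m : nat) (k : T -> nat) :
  (\sum_x k x)%N = m ->
  exists! f : {ffun T -> 'I_m.+1},
    f \in multisets T m /\ forall x, k x = f x.
Proof.
move=> km; have k_le x : (k x < m.+1)%N.
  by rewrite ltnS -km (bigD1 x) //= leq_addr.
exists [ffun x => Ordinal (k_le x)]; split; first split.
- rewrite inE -[X in _ == X]km; apply/eqP.
  by apply: eq_bigr => x _; rewrite ffunE.
- by move=> x; rewrite ffunE.
by move=> f [_ kf]; apply/ffunP => x; apply: val_inj; rewrite ffunE /= kf.
Qed.

(* Products in {perm T} compose from left to right and actions are right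
   actions, so transporting k along g is k \o g^-1: the multiplicity of g x in
   the new function is that of x in k. *)
Definition ffun_perm (T : finType) (X : Type) (k : {ffun T -> X})
    (g : {perm T}) : {ffun T -> X} := [ffun x => k ((g^-1)%g x)].

Lemma ffun_perm1 (T : finType) (X : Type) :
  @ffun_perm T X ^~ 1%g =1 id.
Proof. by move=> k; apply/ffunP => x; rewrite ffunE invg1 perm1. Qed.

Lemma ffun_permM (T : finType) (X : Type) (k : {ffun T -> X}) :
  act_morph (@ffun_perm T X) k.
Proof. by move=> g h; apply/ffunP => x; rewrite !ffunE invMg permM. Qed.

Definition ffun_action (T X : finType) : {action {perm T} &-> {ffun T -> X}} :=
  TotalAction (@ffun_perm1 T X) (@ffun_permM T X).

(* Main.v *)
Require Import Defs.
From mathcomp Require Import all_boot all_order all_fingroup all_algebra.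
From mathcomp Require Import reals.
From mathcomp Require Import ring lra.

(* Counting pairs (s, g) with s g = s reduces both parts to bounding, for each
   g <> 1 separately, the proportion of points of S fixed by g; the strict
   inequality comes from |G| - 1 < |G|.

   A fixed set or multiset of weight m is a function constant on the cycles of
   g, so x^m times their number is at most a product over the cycles O of
   sum_a x^(a |O|), for any x > 0.  A cycle of length i >= 2 contributes
     1 + x^i <= (1 + x^2)^(i/2),  resp.  1 / (1 - x^i) <= (1 - x^2)^(-i/2),
   so n - d fixed points and d moved points give (1 + x)^n xi_1^d for
   x = m / (n - m), resp. (1 - x)^(-n) xi_2^d for x = m / (n + m).  What remains
   is (m+k)^(m+k) / (m^m k^k) <= sqrt (8 m k / (m+k)) C(m+k, m). *)

Set Implicit Arguments.
Unset Strict Implicit.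
Unset Printing Implicit Defensive.

Import Order.TTheory GRing.Theory Num.Theory.

Local Open Scope ring_scope.

(** * A Stirling-free lower bound for binomial coefficients *)

Section Stirling.
Variable R : realFieldType.
Implicit Types (n m k : nat) (x y : R).

(** Multiplying the truncation for [n] by [1 + y] overshoots the one for [n + 1] by the single term
    [N (N - 1) (N - 2) / 6 * y ^+ 4], nonnegative for every natural [N]. *)
Lemma cubic_binomial_le y n : 0 <= y ->
  1 + n%:R * y + n%:R * (n%:R - 1) / 2 * y ^+ 2
    + n%:R * (n%:R - 1) * (n%:R - 2) / 6 * y ^+ 3 <= (1 + y) ^+ n.
Proof.
move=> y0; elim: n => [|n IHn]; first by rewrite expr0; lra.
have y1 : 0 <= 1 + y by lra.
rewrite [leRHS]exprS; apply: le_trans _ (ler_wpM2l y1 IHn).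
rewrite -[n.+1]addn1 natrD -subr_ge0.
set N : R := n%:R.
have -> : (1 + y) * (1 + N * y + N * (N - 1) / 2 * y ^+ 2 +
    N * (N - 1) * (N - 2) / 6 * y ^+ 3) -
  (1 + (N + 1) * y + (N + 1) * (N + 1 - 1) / 2 * y ^+ 2 +
   (N + 1) * (N + 1 - 1) * (N + 1 - 2) / 6 * y ^+ 3) =
  N * (N - 1) * (N - 2) / 6 * y ^+ 4 by field.
rewrite mulr_ge0 ?exprn_ge0 // divr_ge0 //.
rewrite /N; case: (n) => [|[|j]]; rewrite ?mul0r ?subrr ?mulr0 ?mul0r //.
have j0 : 0 <= j%:R :> R by [].
by rewrite -[j.+2]addn2 natrD; apply: mulr_ge0; [apply: mulr_ge0|]; lra.
Qed.

(** For positive [n], the square of [(1 + 1/n)^(n + 1/2)], which decreases to e; squaring keeps the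
    exponent integral. *)
Definition euler_odd_pow n : R := (1 + n%:R^-1) ^+ (2 * n + 1).

Lemma euler_odd_pow_gt0 n : 0 < euler_odd_pow n.
Proof. by rewrite exprn_gt0 // ltr_pwDl // invr_ge0. Qed.

(* After cancellation this is (1 + 1/(n+1))^2 <= (1 + 1/(n(n+2)))^(2n+1), for
   which a second-order expansion of the right-hand side is not enough. *)
Lemma euler_odd_powS_le n : (0 < n)%N -> euler_odd_pow n.+1 <= euler_odd_pow n.
Proof.
move=> n0; rewrite /euler_odd_pow.
have K0 : 1 <= n%:R :> R by rewrite ler1n.
rewrite -[n.+1]addn1 natrD.
set K : R := n%:R in K0 *.
have y0 : 0 <= (K * (K + 2))^-1 by rewrite invr_ge0 mulr_ge0; lra.
have -> : 1 + K^-1 = (1 + (K * (K + 2))^-1) * (1 + (K + 1)^-1).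
  by field; rewrite !gt_eqF; lra.
rewrite (_ : 2 * (n + 1) + 1 = 2 + (2 * n + 1))%N; last first.
  by rewrite mulnDr [(2 * n + 2 * 1)%N]addnC -addnA.
rewrite exprMn exprD; apply: ler_wpM2r.
  by rewrite exprn_ge0 // addr_ge0 // invr_ge0; lra.
apply: le_trans (cubic_binomial_le _ y0).
rewrite natrD natrM -/K -subr_ge0.
have -> : 1 + (2 * K + 1) * (K * (K + 2))^-1
   + (2 * K + 1) * (2 * K + 1 - 1) / 2 * (K * (K + 2))^-1 ^+ 2
   + (2 * K + 1) * (2 * K + 1 - 1) * (2 * K + 1 - 2) / 6
     * (K * (K + 2))^-1 ^+ 3 - (1 + (K + 1)^-1) ^+ 2
  = (K ^+ 4 + 5 * K ^+ 3 + 18 * K ^+ 2 + 16 * K - 1) /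
    (3 * K ^+ 2 * (K + 2) ^+ 3 * (K + 1) ^+ 2).
  by field; rewrite !gt_eqF; lra.
(* As [K >= 1], the term [16 * K] absorbs the only negative one, [- 1]. *)
apply: divr_ge0.
  have pow_ge0 j := exprn_ge0 j (le_trans ler01 K0).
  have := pow_ge0 2; have := pow_ge0 3; have := pow_ge0 4; lra.
by do !apply: mulr_ge0; rewrite ?exprn_ge0; lra.
Qed.

Lemma euler_odd_pow_le n m :
  (0 < n)%N -> euler_odd_pow (n + m) <= euler_odd_pow n.
Proof.
move=> n0; elim: m => [|m IHm]; first by rewrite addn0.
by rewrite addnS; apply: le_trans IHm; rewrite euler_odd_powS_le // addn_gt0 n0.
Qed.

(* By Stirling this is asymptotic to 2 pi exp(-2n).  Its consecutive ratios are
   the inverses of euler_odd_pow, so the monotonicity of the latter makes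
   stirling_sq m * stirling_sq k / stirling_sq (m + k) largest at m = k = 1,
   where it is 8. *)
Definition stirling_sq n : R := (n`!%:R / n%:R ^+ n) ^+ 2 / n%:R.

Lemma stirling_sq_gt0 n : (0 < n)%N -> 0 < stirling_sq n.
Proof.
move=> n0; have N0 : 0 < n%:R :> R by rewrite ltr0n.
by rewrite divr_gt0 ?exprn_gt0 // divr_gt0 ?exprn_gt0 // ltr0n fact_gt0.
Qed.

Lemma stirling_sqS n :
  (0 < n)%N -> stirling_sq n.+1 = stirling_sq n / euler_odd_pow n.
Proof.
move=> n0; rewrite /stirling_sq /euler_odd_pow factS natrM.
have N0 : n%:R != 0 :> R by rewrite pnatr_eq0 -lt0n.
have N1 : n.+1%:R != 0 :> R by rewrite pnatr_eq0.
have -> : 1 + n%:R^-1 = n.+1%:R / n%:R :> R.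
  by rewrite -addn1 natrD; field.
have -> a : a ^+ (2 * n + 1) = a * (a ^+ n) ^+ 2 :> R.
  by rewrite exprD expr1 mulrC mulnC exprM.
rewrite (exprS _ n) (expr_div_n n.+1%:R).
have P0 : n%:R ^+ n != 0 :> R by rewrite expf_neq0.
have P1 : n.+1%:R ^+ n != 0 :> R by rewrite expf_neq0.
move: (n.+1%:R ^+ n) (n%:R ^+ n) P0 P1 => p q p0 q0.
by field; rewrite nat1r N0 N1 p0 q0.
Qed.

Lemma stirling_sq_mul_le m k : (0 < m)%N -> (0 < k)%N ->
  stirling_sq m * stirling_sq k <= 8 * stirling_sq (m + k).
Proof.
move=> m0; case: k => // k _; elim: k => [|k IHk].
  (* Since [stirling_sq 1 = 1], the base case says that [euler_odd_pow m] is at most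
     [euler_odd_pow 1 = 8]. *)
  rewrite {2}/stirling_sq expr1 !divr1 expr1n mulr1 addn1 stirling_sqS //.
  rewrite mulrCA -[leLHS]mulr1; apply: ler_wpM2l.
    exact/ltW/stirling_sq_gt0.
  rewrite ler_pdivlMr ?euler_odd_pow_gt0 // mul1r.
  have := euler_odd_pow_le m.-1 (ltn0Sn 0); rewrite add1n prednK //.
  move=> /le_trans; apply.
  by rewrite /euler_odd_pow invr1 /= !exprS; lra.
have mk0 : (0 < m + k.+1)%N by rewrite addn_gt0 m0.
(* The left side gets divided by [euler_odd_pow k.+1], the right side by [euler_odd_pow (m + k.+1)],
   which is no larger. *)
rewrite addnS (stirling_sqS (ltn0Sn k)) (stirling_sqS mk0).
rewrite (mulrA (stirling_sq m)) (mulrA 8).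
have q0 : 0 <= (euler_odd_pow k.+1)^-1.
  by rewrite invr_ge0 ltW ?euler_odd_pow_gt0.
apply: le_trans (ler_wpM2r q0 IHk) _; apply: ler_wpM2l.
  by rewrite mulr_ge0 // ltW // stirling_sq_gt0 ?addn_gt0 ?m0.
by rewrite lef_pV2 ?posrE ?euler_odd_pow_gt0 // addnC euler_odd_pow_le.
Qed.

(** The factorials collapse by [m! k! C(m+k, m) = (m+k)!]; this turns a bound on [stirling_sq] into
    one on binomials. *)
Lemma stirling_sq_binomial m k : (0 < m)%N -> (0 < k)%N ->
  stirling_sq (m + k) / (stirling_sq m * stirling_sq k) =
  ('C(m + k, m)%:R * m%:R ^+ m * k%:R ^+ k / (m + k)%:R ^+ (m + k)) ^+ 2
   * (m%:R * k%:R / (m + k)%:R).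
Proof.
move=> m0 k0.
have /(congr1 (fun n => n%:R : R)) := bin_fact (leq_addr k m).
rewrite addKn !natrM /stirling_sq => <-.
have nz n : (0 < n)%N -> n%:R != 0 :> R by rewrite pnatr_eq0 -lt0n.
have := nz _ (fact_gt0 m); have := nz _ (fact_gt0 k).
have K0 := nz _ k0; have M0 := nz _ m0.
have MK0 : (m + k)%:R != 0 :> R by rewrite nz ?addn_gt0 ?m0.
have := expf_neq0 m M0; have := expf_neq0 k K0; have := expf_neq0 (m + k) MK0.
move: (_ ^+ (m + k)) (_ ^+ m) (_ ^+ k) => p q r p0 q0 r0 kf mf.
by field; rewrite -natrD MK0 p0 K0 q0 M0 r0 kf mf.
Qed.
End Stirling.

(** The constant 3 of the theorem arises here: after squaring, 9 is needed and [stirling_sq_mul_le]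
    supplies 8. *)
Lemma expn_quotient_le_binomial (R : rcfType) (m k : nat) :
  (0 < m)%N -> (0 < k)%N ->
  (m + k)%:R ^+ (m + k) / (m%:R ^+ m * k%:R ^+ k)
  <= 3 * Num.sqrt (m%:R * k%:R / (m + k)%:R) * 'C(m + k, m)%:R :> R.
Proof.
move=> m0 k0.
have gt0 n : (0 < n)%N -> 0 < n%:R :> R by rewrite ltr0n.
have MK0 : 0 < (m + k)%:R :> R by rewrite gt0 ?addn_gt0 ?m0.
have p0 : 0 < m%:R ^+ m * k%:R ^+ k :> R by rewrite mulr_gt0 // exprn_gt0 ?gt0.
have q0 := exprn_gt0 (m + k) MK0.
have s0 : 0 <= m%:R * k%:R / (m + k)%:R :> R by rewrite divr_ge0 ?mulr_ge0.
have A0 n : (0 < n)%N -> 0 < stirling_sq R n by exact: stirling_sq_gt0.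
have : 1 <= 8 * (stirling_sq R (m + k) / (stirling_sq R m * stirling_sq R k)).
  rewrite (mulrA 8) (ler_pdivlMr _ _ (mulr_gt0 (A0 _ m0) (A0 _ k0))) mul1r.
  exact: stirling_sq_mul_le.
rewrite stirling_sq_binomial //.
set s := _ / _ in s0 *; set L := _ / (_ * _); set C := 'C(_, _)%:R.
have L0 : 0 < L by rewrite divr_gt0.
have -> : C * m%:R ^+ m * k%:R ^+ k / (m + k)%:R ^+ (m + k) = C / L.
  by rewrite /L invf_div !mulrA.
move=> h; have {}h : L ^+ 2 <= 8 * (s * C ^+ 2).
  rewrite -[leLHS]mul1r -ler_pdivlMr ?exprn_gt0 //.
  suff <- : 8 * ((C / L) ^+ 2 * s) = 8 * (s * C ^+ 2) / L ^+ 2 by [].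
  by field; rewrite gt_eqF.
rewrite -ler_sqr ?nnegrE ?(ltW L0) ?mulr_ge0 ?sqrtr_ge0 //.
have -> : (3 * Num.sqrt s * C) ^+ 2 = 9 * (s * C ^+ 2).
  by rewrite -[in RHS](sqr_sqrtr s0); ring.
apply: le_trans h _.
by apply: ler_wpM2r; [rewrite mulr_ge0 ?exprn_ge0|lra].
Qed.

(** * Functions fixed by a permutation *)

Section InvariantFunctions.
Variables (R : numFieldType) (T X : finType) (g : {perm T}).

Lemma ffun_perm_fixP (k : {ffun T -> X}) :
  reflect (forall t, k (g t) = k t) (ffun_perm k g == k).
Proof.
apply: (iffP eqP) => [kg t | kg].
  by rewrite -[in LHS]kg ffunE permK.
by apply/ffunP => t; rewrite ffunE -[in RHS](permKV g t) kg.
Qed.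

Lemma invariant_porbit (k : {ffun T -> X}) (t u : T) :
  (forall v, k (g v) = k v) -> u \in porbit g t -> k u = k t.
Proof.
move=> kg /porbitP[i ->]; elim: i => [|i IHi]; first by rewrite perm1.
by rewrite expgSr permM kg.
Qed.

Local Notation orbit_type := {O : {set T} | O \in porbits g}.

Lemma porbits_repr_ex (O : orbit_type) : exists t, porbit g t == val O.
Proof. by case: O => O /= /imsetP[t _ ->]; exists t. Qed.

Let orb (t : T) : orbit_type := exist _ (porbit g t) (imset_f (porbit g) isT).
Let rep (O : orbit_type) : T := xchoose (porbits_repr_ex O).

Let repK : cancel rep orb.
Proof. by move=> O; apply/val_inj/eqP/(xchooseP (porbits_repr_ex O)). Qed.

Let rep_orb t : rep (orb t) \in porbit g t.
Proof.
by rewrite -eq_porbit_mem; apply/eqP; have /(congr1 val) := repK (orb t).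
Qed.

(** Invariant functions correspond to arbitrary functions on the set of cycles, and these index the
    terms obtained by expanding the right-hand product. Cycles are made a finite type so that
    distributivity applies. *)
Lemma sum_invariant_prod (F : T -> X -> R) :
  \sum_(k : {ffun T -> X} | ffun_perm k g == k) \prod_t F t (k t) =
  \prod_(O in porbits g) \sum_a \prod_(t in O) F t a.
Proof.
rewrite [RHS]big_sub /= bigA_distr_bigA /=.
pose ext (h : {ffun orbit_type -> X}) : {ffun T -> X} := [ffun t => h (orb t)].
pose restr (k : {ffun T -> X}) : {ffun orbit_type -> X} :=
  [ffun O => k (rep O)].
rewrite (reindex_onto ext restr) /=; last first.
  move=> k /ffun_perm_fixP kg; apply/ffunP => t; rewrite !ffunE.
  exact: invariant_porbit.
apply: eq_big => [h|h _].
  apply/andP; split; last by apply/eqP/ffunP => O; rewrite !ffunE repK.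
  apply/ffun_perm_fixP => t; rewrite !ffunE; congr (h _); apply: val_inj => /=.
  by rewrite -{2}[g]expg1 porbit_perm.
rewrite (partition_big orb predT) //=; apply: eq_bigr => O _.
apply: eq_big => [t|t /eqP <-]; last by rewrite ffunE.
by rewrite -(repK O) -val_eqE /= eq_porbit_mem.
Qed.
End InvariantFunctions.

Section FixedPointBound.
Variables (R : numFieldType) (T X : finType) (g : {perm T}) (w : X -> nat).

Lemma cover_porbits : cover (porbits g) = setT.
Proof.
apply/setP => t; rewrite inE; apply/bigcupP; exists (porbit g t).
  exact: imset_f.
exact: porbit_id.
Qed.

Lemma trivIset_porbits : trivIset (porbits g).
Proof.
apply/trivIsetP => _ _ /imsetP[t _ ->] /imsetP[u _ ->]; apply: contraR.
rewrite -setI_eq0 => /set0Pn[v /setIP[]].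
by rewrite -!eq_porbit_mem => /eqP <-.
Qed.

(** A coefficient of a generating function with nonnegative coefficients is bounded by its value at
    [x]. Here [a] pays for a fixed point and [c] for each point of a longer cycle. *)
Lemma card_fixed_weight_le (m : nat) (x a c : R) : 0 <= x -> 0 <= c ->
    \sum_b x ^+ w b <= a ->
    (forall i, (1 < i)%N -> \sum_b (x ^+ i) ^+ w b <= c ^+ i) ->
  #|[set k : {ffun T -> X} | (ffun_perm k g == k) &&
       ((\sum_t w (k t))%N == m)]|%:R * x ^+ m
  <= a ^+ (#|T| - #|moved_points g|) * c ^+ #|moved_points g|.
Proof.
move=> x0 c0 xa xc.
have a0 : 0 <= a.
  by apply: le_trans xa; apply: sumr_ge0 => b _; rewrite exprn_ge0.
apply: (@le_trans _ _
    (\sum_(k : {ffun T -> X} | ffun_perm k g == k) \prod_t x ^+ w (k t))).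
  rewrite [leRHS](bigID (fun k : {ffun T -> X} => (\sum_t w (k t))%N == m)) /=.
  rewrite -[leLHS]addr0; apply: lerD; last first.
    by apply: sumr_ge0 => k _; apply: prodr_ge0 => t _; rewrite exprn_ge0.
  rewrite -sum1dep_card natr_sum mulr_suml le_eqVlt; apply/orP; left; apply/eqP.
  by apply: eq_bigr => k /andP[_ /eqP <-]; rewrite mul1r expr_sum.
rewrite (sum_invariant_prod g (fun _ b => x ^+ w b)).
(* With one factor per point, the bound can be regrouped and compared cycle by cycle. *)
have -> : a ^+ (#|T| - #|moved_points g|) * c ^+ #|moved_points g| =
    \prod_t (if g t != t then c else a).
  rewrite (bigID [in moved_points g]) /= mulrC; congr (_ * _).
    by rewrite -prodr_const; apply: eq_bigr => t; rewrite inE => ->.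
  have -> : (#|T| - #|moved_points g|)%N = #|~: moved_points g|.
    by rewrite [RHS]cardsCs setCK.
  rewrite -prodr_const; apply: eq_big => t; first by rewrite inE.
  by rewrite !inE => /negbTE->.
rewrite [leRHS](eq_bigl [in cover (porbits g)]); last first.
  by move=> t; rewrite cover_porbits !inE.
rewrite (big_trivIset _ trivIset_porbits) /=.
apply: ler_prod => O /imsetP[t _ ->].
apply/andP; split.
  by apply: sumr_ge0 => b _; apply: prodr_ge0 => u _; rewrite exprn_ge0.
under eq_bigr do rewrite prodr_const exprAC.
have fix_orbit u : u \in porbit g t -> (g u == u) = (g t == t).
  move=> /porbitP[i ->]; rewrite -!permM -expgSr expgS permM.
  by rewrite (inj_eq perm_inj).
have [gt|gt] := eqVneq (g t) t.
  have -> : porbit g t = [set t].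
    apply/setP => u; rewrite inE; apply/porbitP/eqP => [[i ->]|->].
      by elim: i => [|i IHi]; rewrite ?perm1 // expgSr permM IHi.
    by exists 0%N; rewrite perm1.
  by rewrite big_set1 gt eqxx /= cards1; under eq_bigr do rewrite expr1.
have -> : \prod_(u in porbit g t) (if g u != u then c else a) =
    c ^+ #|porbit g t|.
  by rewrite -prodr_const; apply: eq_bigr => u /fix_orbit ->; rewrite gt.
(* A cycle with a single element contains both [t] and [g t], so [t] would be fixed. *)
apply: xc; rewrite ltnNge; apply: contra gt => le1.
have /cards1P[v tv] : #|porbit g t| == 1%N.
  by rewrite eqn_leq le1 lt0n card_porbit_neq0.
have := porbit_id g t; have := mem_porbit g 1 t.
by rewrite expg1 tv !inE => /eqP -> /eqP ->.
Qed.
End FixedPointBound.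

(** * Average stabilizer size *)

Section Average.
Variables (R : realType) (aT : finGroupType) (rT : finType)
  (to : {action aT &-> rT}) (G : {group aT}) (S : {set rT}).

Lemma sum_stab_fixed :
  (\sum_(s in S) #|'C_G[s | to]|%g =
   \sum_(g in G) #|[set s in S | to s g == s]|)%N.
Proof.
under eq_bigr do rewrite -sum1_card.
under [RHS]eq_bigr do rewrite -sum1_card.
rewrite (exchange_big_dep [in G]) /=; last by move=> s g _ /setIP[].
apply: eq_bigr => g gG; apply: eq_bigl => s; rewrite !inE gG sub1set inE.
by [].
Qed.

(** In the fixed-point count the identity accounts for the subtracted 1, and each of the other
    [|G| - 1] elements contributes at most [B * #|S|]. *)
Lemma avg_stab_lt (B : R) : (0 < #|S|)%N -> 0 < B ->
  (forall g, g \in G -> g != 1%g ->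
     #|[set s in S | to s g == s]|%:R <= B * #|S|%:R) ->
  (avg_stab R to G S - 1) / #|G|%:R < B.
Proof.
move=> S0 B0 fixB.
have s0 : 0 < #|S|%:R :> R by rewrite ltr0n.
have G0 : 0 < #|G|%:R :> R by rewrite ltr0n cardG_gt0.
rewrite ltr_pdivrMr // ltrBlDr /avg_stab -natr_sum sum_stab_fixed.
rewrite ltr_pdivrMr // natr_sum (bigD1 1%g) //= mulrDl mul1r addrC.
apply: ltr_leD; last first.
  by rewrite ler_nat subset_leq_card //; apply/subsetP => s /setIdP[].
apply: (@le_lt_trans _ _ (\sum_(g in G | g != 1%g) B * #|S|%:R)).
  by apply: ler_sum => g /andP[gG g1]; apply: fixB.
rewrite sumr_const -[ltLHS]mulr_natr mulrAC ltr_pM2r // ltr_pM2l // ltr_nat.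
rewrite [ltnRHS](cardD1 1%g) group1 add1n ltnS subset_leq_card //.
by apply/subsetP => g; rewrite !inE andbC.
Qed.

End Average.

(** * Minimal degree, cardinalities and cycle estimates *)

Lemma minimal_degree_le (T : finType) (G : {group {perm T}}) (g : {perm T}) :
  g \in G -> g != 1%g -> (minimal_degree G <= #|moved_points g|)%N.
Proof.
move=> gG g1; rewrite /minimal_degree.
have := mem_index_enum g; elim: (index_enum _) => // h r IHr.
rewrite inE big_cons => /orP[/eqP <-|/IHr le_r].
  by rewrite gG g1 geq_minl.
by case: ifP => // _; apply: leq_trans (geq_minr _ _) le_r.
Qed.

(** Stars and bars: enumerating [T] turns multisets into the tuples counted by
    [card_ord_partitions], whose length must be a successor. *)
Lemma card_multisets (T : finType) (m : nat) :
  #|T| != 0%N -> #|multisets T m| = 'C(#|T|.-1 + m, #|T|.-1).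
Proof.
move=> T0; have n0 : #|T| = #|T|.-1.+1 by rewrite prednK // lt0n.
rewrite -card_ord_partitions.
pose f (k : {ffun T -> 'I_m.+1}) : #|T|.-1.+1.-tuple 'I_m.+1 :=
  [tuple k (enum_val (cast_ord (esym n0) i)) | i < #|T|.-1.+1].
pose h (t : #|T|.-1.+1.-tuple 'I_m.+1) : {ffun T -> 'I_m.+1} :=
  [ffun x => tnth t (cast_ord n0 (enum_rank x))].
have fK : cancel f h.
  by move=> k; apply/ffunP => x; rewrite ffunE tnth_mktuple cast_ordK
    enum_rankK.
have hK : cancel h f.
  move=> t; apply: eq_from_tnth => i.
  by rewrite tnth_mktuple ffunE enum_valK cast_ordKV.
rewrite -(card_imset _ (can_inj fK)); apply: eq_card => t.
rewrite (can2_imset_pre _ fK hK) !inE; congr (_ == _).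
rewrite big_tuple; under eq_bigr do rewrite ffunE.
rewrite (reindex (fun i => enum_val (cast_ord (esym n0) i))) /=.
  by apply: eq_bigr => i _; rewrite enum_valK cast_ordKV.
exists (fun x => cast_ord n0 (enum_rank x)) => x _.
  by rewrite enum_valK cast_ordKV.
by rewrite cast_ordK enum_rankK.
Qed.

(** Passing to indicator functions lets one weight bound serve both sets and multisets. *)
Lemma card_fixed_sets (T : finType) (g : {perm T}) (m : nat) :
  #|[set A in subsets_of_card T m | ('P^*)%act A g == A]| =
  #|[set k : {ffun T -> bool} | (ffun_perm k g == k) &&
       ((\sum_t k t)%N == m)]|.
Proof.
pose f (A : {set T}) : {ffun T -> bool} := [ffun t => t \in A].
pose h (k : {ffun T -> bool}) : {set T} := [set t | k t].
have fK : cancel f h by move=> A; apply/setP => t; rewrite inE ffunE.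
have hK : cancel h f by move=> k; apply/ffunP => t; rewrite ffunE inE.
have hg k : ('P^*)%act (h k) g = h (ffun_perm k g).
  apply/setP => u; rewrite /= setactE inE ffunE; apply/imsetP/idP => [[t]|ku].
    by rewrite inE => kt ->; rewrite /= apermE permK.
  by exists (g^-1%g u); rewrite ?inE //= apermE permKV.
rewrite -(card_imset _ (can_inj fK)); apply: eq_card => k.
rewrite (can2_imset_pre _ fK hK) !inE hg (can_eq hK) andbC; congr (_ && _).
rewrite -sum1_card big_mkcond /=; congr (_ == _).
by apply: eq_bigr => t _; rewrite inE; case: (k t).
Qed.

(** Both [p] and [q] are at most [s], so raising the exponent by one multiplies the left side by at
    most [s]. Both cycle inequalities are instances. *)
Lemma add_expr_le (R : realDomainType) (p q s : R) (i : nat) :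
  0 <= p -> 0 <= q -> 0 <= s -> p ^+ 2 + q ^+ 2 <= s ^+ 2 -> (1 < i)%N ->
  p ^+ i + q ^+ i <= s ^+ i.
Proof.
move=> p0 q0 s0 pqs; case: i => [|[|i]] // _.
have ps : p <= s.
  by rewrite -ler_sqr ?nnegrE //; apply: le_trans pqs; rewrite lerDl exprn_ge0.
have qs : q <= s.
  by rewrite -ler_sqr ?nnegrE //; apply: le_trans pqs; rewrite lerDr exprn_ge0.
elim: i => // i IHi; rewrite 3!(exprS _ i.+2).
apply: le_trans _ (ler_wpM2l s0 IHi); rewrite mulrDr.
by apply: lerD; apply: ler_wpM2r; rewrite ?exprn_ge0.
Qed.

Lemma sum_geometric_le (R : realFieldType) (y : R) (m : nat) :
  0 <= y -> y < 1 -> \sum_(b < m) y ^+ b <= (1 - y)^-1.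
Proof.
move=> y0 y1; rewrite -[leRHS]mul1r ler_pdivlMr ?subr_gt0 // mulrC.
by rewrite -(opprB y 1) mulNr -subrX1 opprB gerBl exprn_ge0.
Qed.

(** Taking [c = xi * a] gathers all powers of [a] into [a ^+ #|T|]; as [xi <= 1], the number of
    moved points may be lowered to the minimal degree. *)
Lemma card_fixed_weight_le_minimal_degree (R : realType) (T X : finType)
    (G : {group {perm T}}) (g : {perm T}) (w : X -> nat) (m : nat)
    (x a xi : R) :
    g \in G -> g != 1%g -> 0 < x -> 0 <= a -> 0 <= xi <= 1 ->
    \sum_b x ^+ w b <= a ->
    (forall i, (1 < i)%N -> \sum_b (x ^+ i) ^+ w b <= (xi * a) ^+ i) ->
  #|[set k : {ffun T -> X} | (ffun_perm k g == k) &&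
       ((\sum_t w (k t))%N == m)]|%:R
  <= a ^+ #|T| / x ^+ m * xi ^+ minimal_degree G.
Proof.
move=> gG g1 x0 a0 /andP[xi0 xi1] xa xc.
rewrite mulrAC ler_pdivlMr ?exprn_gt0 //.
apply: le_trans (card_fixed_weight_le g m (ltW x0) (mulr_ge0 xi0 a0) xa xc) _.
rewrite exprMn mulrCA -exprD subnK ?max_card // mulrC.
apply: ler_wpM2l; first exact: exprn_ge0.
by apply: ler_wiXn2l => //; apply: minimal_degree_le.
Qed.

(** * The bounds for subsets and for multisets *)

Theorem mainTheorem1 (R : realType) (T : finType) (n : nat) (hn : #|T| = n)
    (G : {group {perm T}}) (hG : G :!=: 1%g) :
  (forall m : nat, (0 < m < n)%N ->
     (avg_stab R ('P^*)%act G (subsets_of_card T m) - 1) / #|G|%:R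
     < 3 * Num.sqrt (m%:R * (n%:R - m%:R) / n%:R)
         * (Num.sqrt (m%:R ^+ 2 + (n%:R - m%:R) ^+ 2) / n%:R)
             ^+ minimal_degree G)
  /\
  (forall m : nat, (0 < m)%N ->
     (avg_stab R (ffun_action T 'I_m.+1) G (multisets T m) - 1) / #|G|%:R
     < 3 * Num.sqrt (m%:R * (n%:R + m%:R) / n%:R)
         * Num.sqrt (n%:R / (n%:R + 2 * m%:R)) ^+ minimal_degree G).
Proof.
(* The symmetric group of an empty set is trivial, against [hG]. *)
have Tgt0 : (0 < n)%N.
  rewrite -hn lt0n; apply: contra hG => /eqP/card0_eq T0.
  apply/eqP/trivgP/subsetP => g _; rewrite inE; apply/eqP/permP => t.
  by have := T0 t; rewrite inE.
have N0 : 0 < n%:R :> R by rewrite ltr0n.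
split=> [m /andP[m0 mn] | m m0]; have M0 : 0 < m%:R :> R by rewrite ltr0n.
  have [k k0 nE] : exists2 k, (0 < k)%N & n = (m + k)%N.
    by exists (n - m)%N; rewrite ?subn_gt0 // subnKC // ltnW.
  have K0 : 0 < k%:R :> R by rewrite ltr0n.
  have -> : n%:R - m%:R = k%:R :> R by rewrite nE natrD addrAC subrr add0r.
  have C0 : (0 < 'C(n, m))%N by rewrite bin_gt0 ltnW.
  have ss0 : 0 < m%:R ^+ 2 + k%:R ^+ 2 :> R by rewrite addr_gt0 ?exprn_gt0.
  set xi := Num.sqrt (m%:R ^+ 2 + _) / _.
  have xi0 : 0 < xi by rewrite divr_gt0 ?sqrtr_gt0.
  have xi2 : xi ^+ 2 = (m%:R ^+ 2 + k%:R ^+ 2) / n%:R ^+ 2.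
    by rewrite expr_div_n sqr_sqrtr // ltW.
  have xi1 : xi <= 1.
    rewrite -(@expr_le1 _ 2) ?(ltW xi0) // xi2 ler_pdivrMr ?exprn_gt0 //.
    rewrite mul1r nE natrD.
    have := mulr_ge0 (ltW M0) (ltW K0); lra.
  have cardS : #|subsets_of_card T m| = 'C(n, m) by rewrite card_draws hn.
  apply: avg_stab_lt.
  - by rewrite cardS.
  - by rewrite mulr_gt0 ?exprn_gt0 // mulr_gt0 // sqrtr_gt0 divr_gt0 ?mulr_gt0.
  move=> g gG g1; rewrite card_fixed_sets cardS.
  have := @card_fixed_weight_le_minimal_degree R T bool G g nat_of_bool m
    (m%:R / k%:R) (n%:R / k%:R) xi gG g1.
  rewrite hn (ltW xi0) xi1 => /(_ (divr_gt0 M0 K0) (ltW (divr_gt0 N0 K0)) isT).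
  have c0 := mulr_ge0 (ltW xi0) (ltW (divr_gt0 N0 K0)).
  (* With [x = m / k] and [a = 1 + x = n / k], this value of [xi] makes the estimate for 2-cycles an
     equality. *)
  have c2 : (xi * (n%:R / k%:R)) ^+ 2 = 1 + (m%:R / k%:R) ^+ 2.
    by rewrite exprMn xi2; field; rewrite !gt_eqF.
  have sum_le i : (1 < i)%N -> \sum_(b : bool) (m%:R / k%:R) ^+ i ^+ b <=
      (xi * (n%:R / k%:R)) ^+ i.
    move=> i1; rewrite big_bool /= expr1 expr0 addrC.
    rewrite -[X in X + _ <= _](expr1n _ i).
    apply: (add_expr_le ler01 (ltW (divr_gt0 M0 K0)) c0 _ i1).
    by rewrite c2 expr1n.
  move=> /(_ _ sum_le) bound; apply: le_trans (bound _) _.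
    rewrite big_bool /= expr1 expr0 nE natrD le_eqVlt; apply/orP; left.
    by apply/eqP; field; rewrite gt_eqF.
  rewrite [leRHS]mulrAC; apply: ler_wpM2r; first by rewrite exprn_ge0 // ltW.
  (* Here [a ^+ n / x ^+ m] is exactly [n^n / (m^m k^k)]. *)
  have := expn_quotient_le_binomial R m0 k0; rewrite -nE; apply: le_trans.
  rewrite le_eqVlt; apply/orP; left; apply/eqP.
  rewrite !expr_div_n [in k%:R ^+ n]nE exprD; field.
  by rewrite !expf_neq0 ?gt_eqF.
have D0 : 0 < n%:R + 2 * m%:R :> R by lra.
have NM0 : 0 < n%:R + m%:R :> R by lra.
set xi := Num.sqrt (n%:R / _).
have xi0 : 0 < xi by rewrite sqrtr_gt0 divr_gt0.
have xi2 : xi ^+ 2 = n%:R / (n%:R + 2 * m%:R).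
  by rewrite sqr_sqrtr // divr_ge0 ?ltW.
have xi1 : xi <= 1.
  by rewrite -(@expr_le1 _ 2) ?(ltW xi0) // xi2 ler_pdivrMr // mul1r; lra.
have cardS : #|multisets T m| = 'C(n.-1 + m, n.-1).
  by rewrite card_multisets hn // -lt0n.
(* This relates the count [C(n+m-1, n-1)] to the [C(m+n, m)] of [expn_quotient_le_binomial]. *)
have cardSR : (#|multisets T m|%:R : R) * (n%:R + m%:R) =
    n%:R * 'C(m + n, m)%:R.
  rewrite cardS -natrD -!natrM; congr (_%:R).
  have := mul_bin_diag (n + m) n.-1; rewrite prednK //.
  have -> : (n + m).-1 = (n.-1 + m)%N by case: (n) Tgt0.
  by rewrite mulnC => ->; rewrite -(bin_sub (leq_addr m n)) addKn addnC.
apply: avg_stab_lt.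
- by rewrite cardS bin_gt0 leq_addr.
- by rewrite mulr_gt0 ?exprn_gt0 // mulr_gt0 // sqrtr_gt0 divr_gt0 ?mulr_gt0.
move=> g gG g1.
rewrite (_ : #|_| = #|[set k : {ffun T -> 'I_m.+1} | (ffun_perm k g == k) &&
    ((\sum_t k t)%N == m)]|); last by apply: eq_card => k; rewrite !inE andbC.
set x : R := m%:R / (n%:R + m%:R).
have x0 : 0 < x by rewrite divr_gt0.
have x1 : x < 1 by rewrite ltr_pdivrMr // mul1r ltrDr.
set a : R := (n%:R + m%:R) / n%:R.
have a0 : 0 < a by rewrite divr_gt0.
have ax : (1 - x)^-1 = a by rewrite /a /x; field; rewrite !gt_eqF //; lra.
have c0 : 0 < (xi * a)^-1 by rewrite invr_gt0 mulr_gt0.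
have c2 : (xi * a)^-1 ^+ 2 = 1 - x ^+ 2.
  by rewrite exprVn exprMn xi2 /a /x; field; rewrite !gt_eqF.
have xi01 : 0 <= xi <= 1 by rewrite ltW.
have sum_le i : (1 < i)%N -> \sum_(b < m.+1) x ^+ i ^+ b <= (xi * a) ^+ i.
  move=> i1; have xi_lt1 : x ^+ i < 1 by rewrite exprn_ilt1 ?ltW // -lt0n ltnW.
  apply: le_trans (sum_geometric_le _ (exprn_ge0 i (ltW x0)) xi_lt1) _.
  (* After inversion the claim reads [(xi * a)^-1 ^+ i + x ^+ i <= 1], with equality at [i = 2] by
     [c2]. *)
  rewrite -[leRHS]invrK -exprVn lef_pV2 ?posrE ?subr_gt0 ?exprn_gt0 //.
  rewrite lerBrDr -[leRHS](expr1n _ i).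
  apply: (add_expr_le (ltW c0) (ltW x0) ler01 _ i1).
  by rewrite c2 expr1n subrK.
have sum1 : \sum_(b < m.+1) x ^+ b <= a by rewrite -ax sum_geometric_le ?ltW.
have := card_fixed_weight_le_minimal_degree m gG g1 x0 (ltW a0) xi01 sum1
  sum_le.
move=> /le_trans; apply; rewrite hn [leRHS]mulrAC; apply: ler_wpM2r.
  by rewrite exprn_ge0 // ltW.
have -> : #|multisets T m|%:R = n%:R / (n%:R + m%:R) * 'C(m + n, m)%:R :> R.
  by rewrite mulrAC -cardSR mulfK ?gt_eqF.
(* The two square roots differ by the factor [a = (n + m) / n], which cancels the [n / (n + m)] in
   the number of multisets. *)
have -> : Num.sqrt (m%:R * (n%:R + m%:R) / n%:R) =
    Num.sqrt (m%:R * n%:R / (m + n)%:R) * a :> R.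
  rewrite -[a in RHS](ger0_norm (ltW a0)) -sqrtr_sqr -sqrtrM.
    by congr Num.sqrt; rewrite /a natrD; field; rewrite !gt_eqF //; lra.
  by rewrite divr_ge0 // mulr_ge0.
rewrite (_ : 3 * (_ * a) * _ = 3 * Num.sqrt (m%:R * n%:R / (m + n)%:R) *
  'C(m + n, m)%:R); last by rewrite /a; field; rewrite !gt_eqF.
apply: le_trans (expn_quotient_le_binomial R m0 Tgt0).
rewrite le_eqVlt; apply/orP; left; apply/eqP.
rewrite /a /x !expr_div_n exprD -natrD (addnC n m); field.
by rewrite !expf_neq0 ?gt_eqF // natrD addrC.
Qed.
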